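(* Fix an instance set $\mathcal{I}$ of an online minimization problem and a fixed consistent set $\Theta\subseteq\mathcal{I}$. Then the optimal DRCR, i.e. the function $$\mathrm{DRCR}^*(\delta)=\inf_{A}\mathrm{DRCR}_{\Theta,\delta}(A),\qquad \delta\in[0,1],$$ where the infimum is over all algorithms $A$, is concave and monotone non-decreasing with respect to $\delta$.
   Context: $\mathcal{I}$ is the set of instances of an online minimization problem, with a fixed class of (possibly randomized) algorithms. For an algorithm $A$ and instance $I$, $\mathrm{ALG}(I)$ is the expected cost of $A$ on $I$ and $\mathrm{OPT}(I)>0$ is the offline optimal cost, so $\mathrm{ALG}(I)/\mathrm{OPT}(I)\ge 1$. The consistent set $\Theta\subseteq\mathcal{I}$ is nonempty. For $\delta\in[0,1]$, $\mathcal{D}_{\Theta,\delta}$ is the set of all probability distributions $d$ on $\mathcal{I}$ with $\Pr_{I\sim d}[I\in\Theta]\ge 1-\delta$ (point masses are allowed; $\Theta$ and the ratio function are taken to be measurable). The distributionally-robust competitive ratio is $$\mathrm{DRCR}_{\Theta,\delta}(A)=\sup_{d\in\mathcal{D}_{\Theta,\delta}}\mathbb{E}_{I\sim d}\left[\frac{\mathrm{ALG}(I)}{\mathrm{OPT}(I)}\right].$$ Values are in $[1,+\infty]$; concavity is understood in the extended-real sense. The class of algorithms does not depend on $\delta$. *)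

(* Defs.v *)
From mathcomp Require Import all_boot all_order all_algebra.
From mathcomp Require Import all_classical all_reals all_analysis.

Set Implicit Arguments.
Unset Strict Implicit.
Unset Printing Implicit Defensive.

Import Order.TTheory GRing.Theory Num.Theory.

Local Open Scope classical_set_scope.
Local Open Scope ring_scope.
Local Open Scope ereal_scope.

Section drcr.
Context {d : measure_display} {I : measurableType d} {R : realType}.

(* [ALG i] is the expected cost, over its internal randomness, of one algorithm
   on the instance [i] (it may be infinite); [OPT i] is the offline optimum. *)
Definition cost_ratio (ALG : I -> \bar R) (OPT : I -> R) (i : I) : \bar R :=
  ALG i / (OPT i)%:E.

Definition ambiguity_set (Theta : set I) (delta : R) : set (probability I R) :=
  [set P : probability I R | (1 - delta)%:E <= P Theta].

(* The expectation is written as an integral because the library's ['E_P[X]]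
   only accepts real-valued [X]. *)
Definition DRCR (OPT : I -> R) (Theta : set I) (delta : R)
    (ALG : I -> \bar R) : \bar R :=
  ereal_sup [set \int[P]_i cost_ratio ALG OPT i | P in ambiguity_set Theta delta].

(* [algorithm] indexes the class of algorithms; [ALG A] is the expected-cost
   function of [A]. *)
Definition optimal_DRCR (algorithm : Type) (ALG : algorithm -> I -> \bar R)
    (OPT : I -> R) (Theta : set I) (delta : R) : \bar R :=
  ereal_inf [set DRCR OPT Theta delta (ALG A) | A in [set: algorithm]].

End drcr.

(* The library's [convex_function] only covers functions into a module over R.
   Here [0 * +oo = 0], so the endpoints [t = 0] and [t = 1] are harmless; the
   definition is meant for functions that do not take the value [-oo]. *)
Definition ereal_concave_on {R : realType} (D : set R) (f : R -> \bar R) : Prop :=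
  forall x y t : R, D x -> D y -> (0 <= t <= 1)%R ->
    t%:E * f x + (1 - t)%:E * f y <= f (t * x + (1 - t) * y)%R.

(* Main.v *)
(* For a fixed algorithm the expected ratio is affine in the distribution, and
   mixing a distribution in the ambiguity set of level x with one of level y
   lands in the ambiguity set of level t x + (1 - t) y; taking suprema shows
   that the DRCR of each algorithm is concave in the level. It is monotone
   because the ambiguity sets are nested, and an infimum over algorithms
   preserves both properties. *)
From HB Require Import structures.
Require Import Defs.
From mathcomp Require Import all_boot all_order all_algebra.
From mathcomp Require Import all_classical all_reals all_analysis.
From mathcomp Require Import measurable_realfun.

Import Order.TTheory GRing.Theory Num.Theory.

Local Open Scope classical_set_scope.
Local Open Scope ring_scope.
Local Open Scope ereal_scope.

Section mixture.
Context {d : measure_display} {T : measurableType d} {R : realType}.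
Variables (P Q : probability T R) (t : R) (t01 : (0 <= t <= 1)%R).

Let t_ge0 : (0 <= t)%R. Proof. by case/andP: t01. Qed.

Let onem_ge0 : (0 <= 1 - t)%R. Proof. by rewrite subr_ge0; case/andP: t01. Qed.

(** Assembling it from [measure_add] and [mscale] makes the measure structure inherited, so that
    only the total mass 1 remains to be checked. *)
Definition mixture : set T -> \bar R :=
  measure_add (mscale (NngNum t_ge0) P) (mscale (NngNum onem_ge0) Q).

HB.instance Definition _ := Measure.on mixture.

Lemma mixtureE A : mixture A = t%:E * P A + (1 - t)%:E * Q A.
Proof. by rewrite /mixture measure_addE. Qed.

Let mixture_setT : mixture [set: T] = 1.
Proof. by rewrite mixtureE !probability_setT !mule1 -EFinD addrC subrK. Qed.

HB.instance Definition _ :=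
  @Measure_isProbability.Build _ _ R mixture mixture_setT.

(** Nonnegativity of [f] replaces integrability, so the identity also covers infinite
    expectations. *)
Lemma ge0_integral_mixture (f : T -> \bar R) :
  (forall x, 0 <= f x) -> measurable_fun [set: T] f ->
  \int[mixture]_x f x = t%:E * \int[P]_x f x + (1 - t)%:E * \int[Q]_x f x.
Proof.
by move=> f0 mf; rewrite ge0_integral_measure_add// !ge0_integral_mscale.
Qed.

End mixture.

Arguments mixture {d T R} P Q {t} t01.

(** The suprema are taken one at a time, the other summand being moved across the inequality.
    Subtraction is safe because, for [c] below [+oo], every nonnegative quantity bounded by [c] is
    finite. *)
Lemma ge_ereal_supD {R : realType} (S U : set (\bar R)) (c : \bar R) :
  S !=set0 -> U !=set0 ->
  (forall x, S x -> 0 <= x) -> (forall y, U y -> 0 <= y) ->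
  (forall x y, S x -> U y -> x + y <= c) -> ereal_sup S + ereal_sup U <= c.
Proof.
move=> [x0 Sx0] [y0 Uy0] S0 U0 SUc.
have [->|cy] := eqVneq c +oo; first exact: leey.
have fin x : 0 <= x -> x <= c -> x \is a fin_num.
  by move=> x_ge0 xc; rewrite ge0_fin_numE// (le_lt_trans xc) ?ltey.
have supSD y : U y -> ereal_sup S + y <= c.
  move=> Uy; have yfin : y \is a fin_num.
    apply: fin; first exact: U0.
    by apply: le_trans (SUc _ _ Sx0 Uy); apply: leeDr; exact: S0.
  rewrite -leeBrDr//; apply: ge_ereal_sup => x Sx.
  by rewrite leeBrDr ?SUc.
have supSfin : ereal_sup S \is a fin_num.
  apply: fin; first by apply: le_ereal_sup_tmp; exists x0; last exact: S0.
  by apply: le_trans (supSD _ Uy0); apply: leeDl; exact: U0.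
rewrite -leeBrDl//; apply: ge_ereal_sup => y Uy.
by rewrite leeBrDl ?supSD.
Qed.

Section drcr.
Context {d : measure_display} {I : measurableType d} {R : realType}.
Variables (OPT : I -> R) (Theta : set I).

(** A point mass inside [Theta] gives [Theta] probability 1, which meets every threshold
    [1 - delta]. *)
Lemma ambiguity_set_neq0 (delta : R) : measurable Theta -> Theta !=set0 ->
  (0 <= delta)%R -> ambiguity_set Theta delta !=set0.
Proof.
move=> mTheta [i Thetai] delta0; exists (dirac i : probability I R).
by rewrite /ambiguity_set/= diracE mem_set// lee_fin gerBl.
Qed.

(** Both the mass of [Theta] and the threshold [1 - delta] are affine, so the two constraints
    combine with the same weights. *)
Lemma ambiguity_set_mixture (x y t : R) (t01 : (0 <= t <= 1)%R)
    (P Q : probability I R) :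
  ambiguity_set Theta x P -> ambiguity_set Theta y Q ->
  ambiguity_set Theta (t * x + (1 - t) * y)%R (mixture P Q t01).
Proof.
have /andP[t0 t1] := t01; rewrite /ambiguity_set/= => xP yQ.
rewrite mixtureE.
rewrite (_ : (1 - _)%:E = t%:E * (1 - x)%:E + (1 - t)%:E * (1 - y)%:E).
  by apply: leeD; apply: lee_wpmul2l; rewrite ?lee_fin ?subr_ge0.
by rewrite -!EFinM -EFinD !mulrBr !mulr1 addrACA subrKC opprD.
Qed.

Lemma le_DRCR (ALG : I -> \bar R) (delta1 delta2 : R) :
  (delta1 <= delta2)%R ->
  DRCR OPT Theta delta1 ALG <= DRCR OPT Theta delta2 ALG.
Proof.
move=> le12; apply: le_ereal_sup; apply: image_subset => P /=.
by apply: le_trans; rewrite lee_fin lerB.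
Qed.

Lemma DRCR_concave (ALG : I -> \bar R) :
  measurable Theta -> Theta !=set0 ->
  (forall i, 0 <= cost_ratio ALG OPT i) ->
  measurable_fun [set: I] (cost_ratio ALG OPT) ->
  ereal_concave_on `[0%R, 1%R] (fun delta => DRCR OPT Theta delta ALG).
Proof.
move=> mTheta Theta0 ratio0 mratio x y t.
rewrite /= !in_itv/= => /andP[x0 _] /andP[y0 _] t01.
have /andP[t0 t1] := t01.
have neq0 delta : (0 <= delta)%R ->
    [set \int[P]_i cost_ratio ALG OPT i | P in ambiguity_set Theta delta]
    !=set0.
  by move=> /(ambiguity_set_neq0 _ mTheta Theta0); exact: image_nonempty.
(* The weights move inside the suprema. Nonemptiness matters for a zero weight: an empty supremum is
   [-oo], whereas [0 * -oo = 0]. *)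
rewrite /DRCR -!ereal_supZl ?subr_ge0//; [|exact/set0P/neq0..].
apply: ge_ereal_supD => [| | | |_ _ [_ [P xP <-] <-] [_ [Q yQ <-] <-]].
- exact/image_nonempty/neq0.
- exact/image_nonempty/neq0.
- by move=> _ [_ [P _ <-] <-]; rewrite mule_ge0 ?lee_fin ?integral_ge0.
- by move=> _ [_ [P _ <-] <-]; rewrite mule_ge0 ?lee_fin ?subr_ge0 ?integral_ge0.
- apply: ereal_sup_ubound; exists (mixture P Q t01).
    exact: ambiguity_set_mixture.
  exact: ge0_integral_mixture.
Qed.

End drcr.

Theorem theorem2 (R : realType) (d : measure_display) (I : measurableType d)
    (algorithm : Type) (ALG : algorithm -> I -> \bar R) (OPT : I -> R)
    (Theta : set I)
    (OPT_gt0 : forall i : I, (0 < OPT i)%R)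
    (ratio_ge1 : forall (A : algorithm) (i : I), 1 <= cost_ratio (ALG A) OPT i)
    (measurable_ratio : forall A : algorithm,
      measurable_fun [set: I] (cost_ratio (ALG A) OPT))
    (measurable_Theta : measurable Theta)
    (Theta_neq0 : Theta !=set0) :
  ereal_concave_on `[0%R, 1%R] (optimal_DRCR ALG OPT Theta) /\
  {in `[0%R, 1%R] &, {homo optimal_DRCR ALG OPT Theta :
    delta1 delta2 / (delta1 <= delta2)%R >-> delta1 <= delta2}}.
Proof.
split=> [x y t x01 y01 t01|delta1 delta2 _ _ le12].
(* One [A] is fixed for the mixed level; the same [A] then bounds the optimal values at both [x] and
   [y] from above. *)
- apply: le_ereal_inf_tmp => _ [A _ <-].
  have /andP[t0 t1] := t01.
  have ratio_ge0 i : 0 <= cost_ratio (ALG A) OPT i.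
    exact: le_trans (ratio_ge1 A i).
  apply: le_trans (DRCR_concave _ _ _ measurable_Theta Theta_neq0 ratio_ge0
    (measurable_ratio A) _ _ _ x01 y01 t01).
  by apply: leeD; apply: lee_wpmul2l; rewrite ?lee_fin ?subr_ge0//;
    apply: ereal_inf_lbound; exists A.
- apply: le_ereal_inf_tmp => _ [A _ <-].
  by apply: ge_ereal_inf; exists (DRCR OPT Theta delta1 (ALG A));
    [exists A|exact: le_DRCR].
Qed.
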